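(* Let $X$ and $Y$ be Banach spaces, let $\mu_0$ be a Borel probability measure on $X$, and let $\Phi,\Phi_N:X\times Y\to\mathbb{R}$ ($N\in\mathbb{N}$). For a fixed $y\in Y$ and all values of $N$, let $\mu^y$ and $\mu^y_N$ be defined via $$\frac{d\mu^y}{d\mu_0}(u)=\frac{1}{Z(y)}\exp(-\Phi(u;y)),\quad Z(y)=\int_X\exp(-\Phi(u;y))\,d\mu_0(u),$$ $$\frac{d\mu^y_N}{d\mu_0}(u)=\frac{1}{Z_N(y)}\exp(-\Phi_N(u;y)),\quad Z_N(y)=\int_X\exp(-\Phi_N(u;y))\,d\mu_0(u),$$ both absolutely continuous with respect to $\mu_0$. Assume that both $\Phi$ and $\Phi_N$ satisfy the following two conditions, uniformly for all $N$ (the same $f_1$ and the same constants for all $N$): (A) there is a positive non-decreasing function $f_1:\mathbb{R}_+\to[1,\infty)$ such that for every $r>0$ there is a constant $M(r)\in\mathbb{R}$ with $\Phi(u;y)\ge M(r)-\log(f_1(\|u\|_X))$ for all $u\in X$ and $y\in B_Y(r)$ (and likewise for $\Phi_N$); (B) for every $r>0$ there is a constant $K(r)>0$ with $\Phi(u;y)\le K(r)$ for all $u\in B_X(r)$ and $y\in B_Y(r)$ (and likewise for $\Phi_N$). Assume also that there exists a positive non-decreasing function $f_3:\mathbb{R}_+\to\mathbb{R}_+$ such that $$|\Phi(u;y)-\Phi_N(u;y)|\le f_3(\|u\|_X)\rho(N),$$ where $\rho(N)\to0$ as $N\to\infty$. (i) If $f_3(\|\cdot\|_X)f_1(\|\cdot\|_X)\in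 L^1(X,\mu_0)$, then there exists a constant $D>0$, independent of $N$, such that $d_{TV}(\mu^y,\mu^y_N)\le D\rho(N)$. (ii) If $(f_3(\|\cdot\|_X))^2f_1(\|\cdot\|_X)\in L^1(X,\mu_0)$, then there exists a constant $D'>0$, independent of $N$, such that $d_H(\mu^y,\mu^y_N)\le D'\rho(N)$.
   Context: $\mathbb{R}_+=[0,\infty)$. $B_X(r)$ and $B_Y(r)$ denote the open balls of radius $r$ centered at the origin. $X$ is not assumed separable; all probability measures are complete. For $\mu_1,\mu_2\ll\nu$, $d_{TV}(\mu_1,\mu_2)=\frac12\int_X\left|\frac{d\mu_1}{d\nu}-\frac{d\mu_2}{d\nu}\right|d\nu$ and $d_H(\mu_1,\mu_2)=\left(\frac12\int_X\left(\sqrt{\frac{d\mu_1}{d\nu}}-\sqrt{\frac{d\mu_2}{d\nu}}\right)^2d\nu\right)^{1/2}$ (independent of $\nu$). *)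

(* Defs.v *)
From HB Require Import structures.
From mathcomp Require Import all_boot all_order all_algebra.
From mathcomp Require Import all_classical all_reals all_analysis.

Set Implicit Arguments.
Unset Strict Implicit.
Unset Printing Implicit Defensive.

Import Order.TTheory GRing.Theory Num.Theory.
Import numFieldNormedType.Exports.

Local Open Scope classical_set_scope.
Local Open Scope ring_scope.

Definition borel_type (R : realType) (X : completeNormedModType R) :=
  g_sigma_algebraType (@open X).

(** The carrier of the completion of [mu] is [T] with the sigma-algebra of the
    Caratheodory-measurable sets of the outer measure [mu^*]; for a finite
    measure this is the sigma-algebra generated by the measurable sets and the
    [mu]-negligible sets. *)
Definition completed_type d (T : measurableType d) (R : realType)
    (mu : probability T R) : measurableType _ :=
  caratheodory_type (mu^*)%mu.

Definition completion d (T : measurableType d) (R : realType)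
    (mu : probability T R) : set (completed_type mu) -> \bar R :=
  @completed_measure_extension _ T R mu.
Arguments completion {d T R} mu _.

Section completion_probability.
Context d (T : measurableType d) (R : realType) (mu : probability T R).

HB.instance Definition _ :=
  Measure.copy (completion mu) (@completed_measure_extension _ T R mu).

Let completion_setT : completion mu [set: completed_type mu] = 1%E.
Proof.
rewrite /completion /completed_measure_extension measurable_mu_extE//.
exact: probability_setT.
Qed.

HB.instance Definition _ :=
  Measure_isProbability.Build _ _ _ (completion mu) completion_setT.

End completion_probability.

Section densities.
Context d (T : measurableType d) (R : realType).
Implicit Types mu nu : probability T R.
Local Open Scope ereal_scope.
Local Open Scope charge_scope.

Definition density nu mu : T -> \bar R :=
  'd (charge_of_finite_measure nu) '/d mu.

(** The first argument [nu] is the reference measure; the value is meaningful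
    when it dominates both [mu1] and [mu2], and then does not depend on it. *)
Definition dTV nu mu1 mu2 : \bar R :=
  2^-1%:E * \int[nu]_u `|density mu1 nu u - density mu2 nu u|.

Definition dH nu mu1 mu2 : \bar R :=
  sqrte (2^-1%:E *
    \int[nu]_u (sqrte (density mu1 nu u) - sqrte (density mu2 nu u)) ^+ 2).

(** [mu] has density [exp(- phi) / Z] with respect to [mu0]. No separate
    measurability of [phi] is required: since [mu] has mass 1, the constant
    [(fine Z)^-1] cannot vanish, so [phi] agrees [mu0]-a.e. with a measurable
    function and [Z] is positive and finite. *)
Definition gibbs_measure mu0 (phi : T -> R) mu : Prop :=
  let Z := \int[mu0]_u (expR (- phi u))%:E in
  mu `<< mu0 /\
  {ae mu0, forall u, density mu mu0 u = ((fine Z)^-1 * expR (- phi u))%:E}.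

End densities.

Section potentials.
Context (R : realType) (X Y : completeNormedModType R).

Definition lower_bound_on (f1 : R -> R) (r M : R) (Phi : X -> Y -> R) : Prop :=
  forall u y, ball (0 : Y) r y -> M - ln (f1 `|u|) <= Phi u y.

Definition upper_bound_on (r K : R) (Phi : X -> Y -> R) : Prop :=
  forall u y, ball (0 : X) r u -> ball (0 : Y) r y -> Phi u y <= K.

End potentials.

(* Main.v *)
Require Import Defs.
From HB Require Import structures.
From mathcomp Require Import all_boot all_order all_algebra.
From mathcomp Require Import all_classical all_reals all_analysis.
From mathcomp Require Import measurable_realfun ring lra.

Set Implicit Arguments.
Unset Strict Implicit.
Unset Printing Implicit Defensive.

Import Order.TTheory GRing.Theory Num.Theory.
Import numFieldNormedType.Exports.

Local Open Scope classical_set_scope.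
Local Open Scope ring_scope.

(** Write the densities of the two posteriors as [p = c * expR (- phi)] and
    [q = c' * expR (- phi')]; both have integral [1], so every question about
    the normalizing constants can be asked of the densities themselves.

    Two estimates carry the proof. The first compares the unnormalized weights:
    [expR] is Lipschitz, with constant [expR (- m)], on the arguments at
    most [- m] ([lipschitz_expRN]), so the lower bound
    [M - ln (f1 `|u|)] on the potentials gives
      [`|expR (- phi u) - expR (- phi' u)|
        <= expR (- M) * f1 `|u| * f3 `|u| * rho N],
    and the same argument applied to the halved potentials bounds the squared
    difference of the square roots of the weights by a multiple of
    [f1 `|u| * f3 `|u| ^+ 2 * rho N ^+ 2].

    The second passes from weights to normalized densities without ever
    comparing [c] and [c'] to each other. For total variation, replacing [p] by
    the rescaled [c' / c * p] costs at most a factor [2], because [p] and [q]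
    have the same mass ([Rintegral_dist_rescale]). For the Hellinger distance,
    expanding the squares shows that normalizing does not increase the squared
    distance of the square roots of the weights beyond the factor
    [Num.sqrt (c * c')], by the arithmetic-geometric inequality
    [sqrt (c' / c) + sqrt (c / c') >= 2] ([Rintegral_sqr_sqrtB_rescale]).

    What remains is a bound on [c] and [c'] uniform in [N]. Some ball [B] has
    positive mass ([exists_ball_completion_gt0]), and the potentials are at most
    [K] there, whence [c * expR (- K) * mu0 B <= 1]
    ([gibbs_density_cst_le]). *)

(** * The exponential and real-valued integrals *)

(** For [a <= b] the difference is [expR (- a) * (1 - expR (a - b))], and
    [1 + x <= expR x] bounds the second factor by [b - a]. *)
Lemma lipschitz_expRN (R : realType) (m a b : R) : m <= a -> m <= b ->
  `|expR (- a) - expR (- b)| <= expR (- m) * `|a - b|.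
Proof.
wlog le_ab : a b / a <= b => [wlg ma mb|ma _].
  have [le_ab|/ltW le_ba] := leP a b; first exact: wlg.
  by rewrite distrC [in leRHS]distrC; exact: wlg.
have dexp : expR (- a) - expR (- b) = expR (- a) * (1 - expR (a - b)).
  by rewrite mulrBr mulr1 -expRD addrA addNr sub0r.
rewrite dexp normrM (ger0_norm (expR_ge0 _)) ler_pM ?expR_ge0//.
  by rewrite ler_expR lerN2.
have := expR_ge1Dx (a - b).
have : expR (a - b) <= 1 by rewrite -expR0 ler_expR subr_le0.
by move=> h1 h2; rewrite ger0_norm ?subr_ge0// ler0_norm ?subr_le0//; lra.
Qed.

Section real_integrals.
Context d (T : measurableType d) (R : realType).
Variable mu : {measure set T -> \bar R}.
Implicit Types f g p q : T -> R.
Local Notation mu_int f := (mu.-integrable setT (EFin \o f)).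

(** Radon-Nikodym densities satisfy pointwise inequalities, nonnegativity
    included, only almost everywhere; this and the next lemma let them be
    handled as ordinary nonnegative functions. *)
Lemma ae_le_Rintegral f g : mu_int f -> mu_int g ->
  {ae mu, forall x, f x <= g x} -> \int[mu]_x f x <= \int[mu]_x g x.
Proof.
move=> fi gi fg; have gfi : mu_int (g \- f) by exact: (integrableB _ gi fi).
rewrite -subr_ge0 -RintegralB// /Rintegral fine_ge0//.
rewrite (@ae_eq_integral _ _ _ mu setT (EFin \o (fun x => `|g x - f x|)))//.
- by apply: integral_ge0 => x _; rewrite lee_fin.
- exact: measurable_int gfi.
- exact: measurable_int (integrable_norm gfi).
- by apply: filterS fg => x fgx _ /=; rewrite ger0_norm// subr_ge0.
Qed.

Lemma ae_le_integrable f g : measurable_fun setT f -> mu_int g ->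
  {ae mu, forall x, `|f x| <= g x} -> mu_int f.
Proof.
move=> mf gi fg.
have mEf : measurable_fun setT (EFin \o f) by exact/measurable_EFinP.
apply/integrableP; split => //.
have /integrableP[mg] := integrable_norm gi.
apply: le_lt_trans; apply: ae_ge0_le_integral => //.
- exact: measurableT_comp mEf.
- exact: measurableT_comp mg.
- apply: filterS fg => x fgx _ /=.
  by rewrite lee_fin normr_id (le_trans fgx)// ler_norm.
Qed.

End real_integrals.

(** * Functions of equal mass and their rescalings *)

Section normalized_densities.
Context d (T : measurableType d) (R : realType).
Variable mu : {measure set T -> \bar R}.
Variables p q : T -> R.
Local Notation mu_int f := (mu.-integrable setT (EFin \o f)).
Hypotheses (ip : mu_int p) (iq : mu_int q).
Hypotheses (p0 : {ae mu, forall x, 0 <= p x}) (q0 : {ae mu, forall x, 0 <= q x}).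
Hypotheses (p1 : \int[mu]_x p x = 1) (q1 : \int[mu]_x q x = 1).

(** The triangle inequality through [t * p] leaves the term
    [`|1 - t| * p], whose integral [`|1 - t|] is itself the absolute value of
    the integral of [q - t * p], because [p] and [q] have mass [1]. *)
Lemma Rintegral_dist_rescale (t : R) :
  \int[mu]_x `|p x - q x| <= 2 * \int[mu]_x `|q x - t * p x|.
Proof.
have itp : mu_int (fun x => t * p x) by exact: (integrableZl _ t ip).
have iqtp : mu_int (fun x => q x - t * p x) by exact: (integrableB _ iq itp).
have inorm := integrable_norm iqtp.
have idefect : mu_int (fun x => `|1 - t| * p x).
  exact: (integrableZl _ `|1 - t| ip).
have defect_le : `|1 - t| <= \int[mu]_x `|q x - t * p x|.
  rewrite -[in X in X <= _]q1 -[in X in X <= _](mulr1 t) -p1 -RintegralZl//.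
  by rewrite -RintegralB// le_normr_Rintegral.
apply: (@le_trans _ _ (\int[mu]_x (`|q x - t * p x| + `|1 - t| * p x))).
  apply: ae_le_Rintegral.
  - exact: (integrable_norm (integrableB _ ip iq)).
  - exact: (integrableD _ inorm idefect).
  - apply: filterS p0 => x px0 /=.
    have -> : p x - q x = (1 - t) * p x - (q x - t * p x) by ring.
    rewrite [leRHS]addrC (le_trans (ler_normB _ _))// lerD2r.
    by rewrite normrM (ger0_norm px0).
rewrite RintegralD// RintegralZl// p1 mulr1; lra.
Qed.

Let sqrt_measurable f : mu_int f -> measurable_fun setT (fun x => Num.sqrt (f x)).
Proof.
move=> /measurable_int/measurable_EFinP mf.
apply: measurableT_comp mf; exact: continuous_measurable_fun (@sqrt_continuous R).
Qed.

Lemma integrable_sqr_sqrtB (a b : R) :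
  mu_int (fun x => (a * Num.sqrt (p x) - b * Num.sqrt (q x)) ^+ 2).
Proof.
apply: (@ae_le_integrable _ _ _ mu _
    (fun x => 2 * a ^+ 2 * p x + 2 * b ^+ 2 * q x)).
- apply: measurable_funX; apply: measurable_funB;
    by apply: measurable_funM => //; exact: sqrt_measurable.
- by apply: (integrableD _ (integrableZl _ _ ip) (integrableZl _ _ iq)).
- apply: filterS2 p0 q0 => x px qx /=.
  rewrite ger0_norm ?sqr_ge0//.
  rewrite -[in leRHS](sqr_sqrtr px) -[in leRHS](sqr_sqrtr qx).
  have := sqr_ge0 (a * Num.sqrt (p x) + b * Num.sqrt (q x)).
  by nra.
Qed.

(** Pointwise, [a * b * (sqrt p / a - sqrt q / b) ^+ 2] exceeds
    [(sqrt p - sqrt q) ^+ 2] by [(b / a - 1) * p + (a / b - 1) * q], whose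
    integral is [(a - b) ^+ 2 / (a * b) >= 0] since [p] and [q] have mass [1]. *)
Lemma Rintegral_sqr_sqrtB_rescale (a b : R) : 0 < a -> 0 < b ->
  \int[mu]_x (Num.sqrt (p x) - Num.sqrt (q x)) ^+ 2 <=
  a * b * \int[mu]_x (Num.sqrt (p x) / a - Num.sqrt (q x) / b) ^+ 2.
Proof.
move=> a0 b0.
have i2 : mu_int (fun x => (Num.sqrt (p x) / a - Num.sqrt (q x) / b) ^+ 2).
  apply: eq_integrable (integrable_sqr_sqrtB a^-1 b^-1) => // x _ /=.
  by rewrite mulrC (mulrC b^-1).
have i1 : mu_int (fun x => (Num.sqrt (p x) - Num.sqrt (q x)) ^+ 2).
  apply: eq_integrable (integrable_sqr_sqrtB 1 1) => // x _ /=.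
  by rewrite !mul1r.
have izp : mu_int (fun x => (b / a - 1) * p x).
  exact: (integrableZl _ (b / a - 1) ip).
have izq : mu_int (fun x => (a / b - 1) * q x).
  exact: (integrableZl _ (a / b - 1) iq).
have izpq : mu_int (fun x => (b / a - 1) * p x + (a / b - 1) * q x).
  exact: (integrableD _ izp izq).
rewrite -RintegralZl//.
apply: (@le_trans _ _ (\int[mu]_x ((Num.sqrt (p x) - Num.sqrt (q x)) ^+ 2 +
    ((b / a - 1) * p x + (a / b - 1) * q x)))).
  rewrite RintegralD// RintegralD// !RintegralZl// p1 q1 !mulr1 lerDl.
  have -> : b / a - 1 + (a / b - 1) = (a - b) ^+ 2 / (a * b).
    by field; rewrite !gt_eqF.
  by rewrite divr_ge0 ?sqr_ge0// mulr_ge0// ltW.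
apply: ae_le_Rintegral.
- exact: (integrableD _ i1 izpq).
- exact: (integrableZl _ (a * b) i2).
- apply: filterS2 p0 q0 => x px qx /=.
  rewrite -[X in (b / a - 1) * X](sqr_sqrtr px).
  rewrite -[X in (a / b - 1) * X](sqr_sqrtr qx).
  rewrite le_eqVlt; apply/orP; left; apply/eqP.
  by field; rewrite !gt_eqF.
Qed.

End normalized_densities.

(** * Distances between Gibbs measures *)

Section gibbs_densities.
Context d (T : measurableType d) (R : realType).
Variable mu : probability T R.
Implicit Types (nu : probability T R) (phi p F : T -> R).
Local Notation mu_int f := (mu.-integrable setT (EFin \o f)).

(** The total mass [1] determines [c] as the reciprocal of the partition
    function. Bounds on [c] are read off from the mass of [p], whose
    measurability and integrability come with the Radon-Nikodym theorem. *)
Definition gibbs_density phi p c : Prop :=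
  [/\ mu_int p, \int[mu]_x p x = 1, 0 < c &
      {ae mu, forall x, p x = c * expR (- phi x)}].

(** The constant cannot vanish, for otherwise the density would integrate to
    [0] instead of [1]; this covers the degenerate values [0] and [+oo] of the
    partition function, whose [fine] is [0]. *)
Lemma gibbs_measure_density phi nu : gibbs_measure mu phi nu ->
  exists p c, (forall x, density nu mu x = (p x)%:E) /\ gibbs_density phi p c.
Proof.
move=> [numu phiE].
set c := (fine _)^-1 in phiE.
have c_ge0 : 0 <= c.
  by rewrite invr_ge0 fine_ge0// integral_ge0// => x _; rewrite lee_fin expR_ge0.
pose p x := fine (density nu mu x).
have pE x : density nu mu x = (p x)%:E.
  by rewrite fineK//; exact: Radon_Nikodym_fin_num.
have ip : mu_int p.
  rewrite (_ : EFin \o p = density nu mu); last by apply/funext => x; rewrite pE.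
  exact: Radon_Nikodym_integrable.
have p1 : \int[mu]_x p x = 1.
  rewrite /Rintegral; under eq_integral do rewrite -pE.
  by rewrite -Radon_Nikodym_integral// [X in fine X]probability_setT.
have pc : {ae mu, forall x, p x = c * expR (- phi x)}.
  by apply: filterS phiE => x; rewrite pE => -[].
exists p, c; split => //; split => //.
rewrite lt_neqAle c_ge0 andbT eq_sym; apply/negP => /eqP c0.
have : \int[mu]_x p x <= \int[mu]_x (cst 0 x : R).
  apply: ae_le_Rintegral => //; first exact: integrable0.
  by apply: filterS pc => x ->; rewrite c0 mul0r.
by rewrite p1 Rintegral_cst// mul0r ler10.
Qed.

Lemma gibbs_density_ge0 phi p c : gibbs_density phi p c ->
  {ae mu, forall x, 0 <= p x}.
Proof.
by move=> [_ _ c0 pc]; apply: filterS pc => x ->; rewrite mulr_ge0 ?expR_ge0 ?ltW.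
Qed.

(** On [A] the density is at least [c * expR (- K)], and its mass is [1]. *)
Lemma gibbs_density_cst_le phi p c (A : set T) (K : R) :
  gibbs_density phi p c -> measurable A -> (0 < mu A)%E ->
  (forall x, A x -> phi x <= K) -> c <= expR K / fine (mu A).
Proof.
move=> gp mA muA0 phiK; have p0 := gibbs_density_ge0 gp.
case: gp => ip p1 c0 pc.
have fA0 : 0 < fine (mu A) by rewrite fine_gt0// muA0 ltey_eq fin_num_measure.
have iA : mu_int (fun x => c * expR (- K) * \1_A x).
  exact: (integrableZl _ (c * expR (- K)) (integrable_indic mu mA)).
rewrite ler_pdivlMr//.
have : \int[mu]_x (c * expR (- K) * \1_A x) <= \int[mu]_x p x.
  apply: ae_le_Rintegral => //; apply: filterS2 p0 pc => x px pcx.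
  rewrite indicE; have [/set_mem Ax|_] := boolP (x \in A); last by rewrite mulr0.
  by rewrite mulr1 pcx ler_pM2l// ler_expR lerN2 phiK.
rewrite p1 RintegralZl//; last exact: integrable_indic.
rewrite {1}/Rintegral integral_indic// setIT => h.
rewrite -(ler_pM2r (expR_gt0 (- K))) -expRD subrr expR0.
by rewrite mulrAC.
Qed.

(** Rescaling by [t = c' / c] gives the two densities the common constant [c'],
    so that [q - t * p] is [c'] times the difference of the weights. The factor
    [2] lost in rescaling cancels the [1/2] in the definition of [dTV]. *)
Lemma dTV_gibbs_le phi phi' nu nu' (A : set T) (K : R) F :
  gibbs_measure mu phi nu -> gibbs_measure mu phi' nu' ->
  measurable A -> (0 < mu A)%E -> (forall x, A x -> phi' x <= K) ->
  mu_int F -> (forall x, `|expR (- phi x) - expR (- phi' x)| <= F x) ->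
  (dTV mu nu nu' <= (expR K / fine (mu A) * \int[mu]_x F x)%:E)%E.
Proof.
move=> /gibbs_measure_density[p [c [pE gp]]] /gibbs_measure_density[q [c' [qE gq]]].
move=> mA muA0 phiK iF leF.
have c'le := gibbs_density_cst_le gq mA muA0 phiK.
have p0 := gibbs_density_ge0 gp.
case: gp gq => [ip p1 c0 pc] [iq q1 c'0 qc].
rewrite /dTV; under eq_integral do rewrite pE qE -EFinB abse_EFin.
rewrite -[X in (_ * X <= _)%E]fineK; last first.
  exact: integrable_fin_num (integrable_norm (integrableB _ ip iq)).
rewrite -EFinM lee_fin.
have := Rintegral_dist_rescale ip iq p0 p1 q1 (c' / c).
rewrite {1}/Rintegral -ler_pdivrMl// => /le_trans; apply.
apply: (@le_trans _ _ (\int[mu]_x (c' * F x))).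
  apply: ae_le_Rintegral.
  - exact: (integrable_norm (integrableB _ iq (integrableZl _ (c' / c) ip))).
  - exact: (integrableZl _ c' iF).
  - apply: filterS2 pc qc => x pcx qcx /=.
    rewrite pcx qcx mulrA divfK ?gt_eqF// -mulrBr normrM (gtr0_norm c'0).
    by rewrite ler_pM2l// distrC.
rewrite RintegralZl// ler_wpM2r// Rintegral_ge0// => x _.
exact: le_trans (leF x).
Qed.

(** Rescaling by [a = sqrt c] and [b = sqrt c'] turns the square roots of the
    densities into the square roots [expR (- (phi x / 2))] and
    [expR (- (phi' x / 2))] of the weights. *)
Lemma dH_gibbs_le phi phi' nu nu' (A : set T) (K : R) F :
  gibbs_measure mu phi nu -> gibbs_measure mu phi' nu' ->
  measurable A -> (0 < mu A)%E -> (forall x, A x -> phi x <= K) ->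
  (forall x, A x -> phi' x <= K) ->
  mu_int F ->
  (forall x, (expR (- (phi x / 2)) - expR (- (phi' x / 2))) ^+ 2 <= F x) ->
  (dH mu nu nu' <=
    (Num.sqrt (2^-1 * (expR K / fine (mu A) * \int[mu]_x F x)))%:E)%E.
Proof.
move=> /gibbs_measure_density[p [c [pE gp]]] /gibbs_measure_density[q [c' [qE gq]]].
move=> mA muA0 phiK phi'K iF leF.
have cle := gibbs_density_cst_le gp mA muA0 phiK.
have c'le := gibbs_density_cst_le gq mA muA0 phi'K.
have p0 := gibbs_density_ge0 gp; have q0 := gibbs_density_ge0 gq.
case: gp gq => [ip p1 c0 pc] [iq q1 c'0 qc].
have sc0 : 0 < Num.sqrt c by rewrite sqrtr_gt0.
have sc'0 : 0 < Num.sqrt c' by rewrite sqrtr_gt0.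
rewrite /dH; under eq_integral do rewrite pE qE -EFinB -EFin_expe.
rewrite -[X in (_ * X)%E]fineK; last first.
  apply: integrable_fin_num => //.
  apply: eq_integrable (integrable_sqr_sqrtB ip iq p0 q0 1 1) => // x _ /=.
  by rewrite !mul1r.
rewrite -EFinM /= lee_fin ler_wsqrtr// ler_pM2l ?invr_gt0//.
have := Rintegral_sqr_sqrtB_rescale ip iq p0 q0 p1 q1 sc0 sc'0.
rewrite {1}/Rintegral => /le_trans; apply.
have sqrt_gibbs (b s : R) : 0 < b ->
    Num.sqrt (b * expR (- s)) / Num.sqrt b = expR (- (s / 2)).
  move=> b0; rewrite sqrtrM ?ltW// mulrAC divff ?mul1r ?gt_eqF ?sqrtr_gt0//.
  rewrite [in LHS](splitr s) opprD expRD -expr2 sqrtr_sqr.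
  by rewrite ger0_norm ?expR_ge0.
have leI : \int[mu]_x (Num.sqrt (p x) / Num.sqrt c -
    Num.sqrt (q x) / Num.sqrt c') ^+ 2 <= \int[mu]_x F x.
  apply: ae_le_Rintegral => //.
  - have := integrable_sqr_sqrtB ip iq p0 q0 (Num.sqrt c)^-1 (Num.sqrt c')^-1.
    apply: eq_integrable => // x _ /=.
    by rewrite mulrC (mulrC (Num.sqrt c')^-1).
  - apply: filterS2 pc qc => x pcx qcx /=.
    by rewrite pcx qcx !sqrt_gibbs.
have C0 : 0 <= expR K / fine (mu A) by exact: le_trans (ltW c0) cle.
apply: ler_pM => //.
  by apply: Rintegral_ge0 => x _; exact: sqr_ge0.
rewrite -[leRHS]sqr_sqrtr// expr2.
by apply: ler_pM; rewrite ?ler_wsqrtr// ltW.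
Qed.

End gibbs_densities.

(** * A ball of positive mass *)

Section balls.
Context (R : realType) (X : completeNormedModType R).
Variable mu0 : probability (borel_type X) R.

Lemma completion_measurable_open (U : set X) : open U ->
  measurable (U : set (completed_type mu0)).
Proof.
by move=> oU; apply: caratheodory_measurable_mu_ext; exact: sub_sigma_algebra.
Qed.

(** The balls of radius [n.+1] increase to the whole space, so their masses
    tend to [1]. *)
Lemma exists_ball_completion_gt0 : exists2 r : R, 0 < r &
  (0 < completion mu0 (ball (0%R : X) r))%E.
Proof.
pose B n : set (completed_type mu0) := ball (0 : X) n.+1%:R.
have mB n : measurable (B n) by exact: completion_measurable_open (ball_open _ _).
have BT : \bigcup_n B n = setT.
  apply/seteqP; split => // x _.
  exists (Num.truncn `|x : X|) => //.
  by rewrite /B -ball_normE /= sub0r normrN truncnS_gt.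
have : (completion mu0 \o B) n @[n --> \oo] --> completion mu0 (\bigcup_n B n).
  apply: nondecreasing_cvg_mu => //; first by rewrite BT.
  move=> m n mn; apply/subsetPset; apply: le_ball.
  by rewrite ler_nat ltnS.
rewrite BT probability_setT => cvgB.
apply: contrapT => noball.
have B0 n : completion mu0 (B n) = 0%E.
  apply/eqP; rewrite eq_le measure_ge0 andbT leNgt; apply/negP => Bn.
  by apply: noball; exists n.+1%:R.
have : (0 : \bar R)%E = 1%E.
  apply: (cvg_unique _ _ cvgB); first exact: ereal_hausdorff.
  by apply: cvg_near_cst; apply: nearW => n /=; exact: B0.
by move=> /eqP; rewrite eqe eq_sym oner_eq0.
Qed.

End balls.

(** * Stability of the posterior under perturbation of the potential *)

Theorem theorem5p2 (R : realType) (X Y : completeNormedModType R)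
    (mu0 : probability (borel_type X) R)
    (Phi : X -> Y -> R) (PhiN : nat -> X -> Y -> R) (y : Y)
    (muy : probability (completed_type mu0) R)
    (muyN : nat -> probability (completed_type mu0) R)
    (f1 f3 : R -> R) (rho : nat -> R)
    (muyE : gibbs_measure (completion mu0) (fun u => Phi u y) muy)
    (muyNE : forall N : nat,
      gibbs_measure (completion mu0) (fun u => PhiN N u y) (muyN N))
    (f1_ge1 : forall s, 0 <= s -> 1 <= f1 s)
    (f1_nd : {in Num.nneg &, {homo f1 : s t / s <= t}})
    (condA : forall r, 0 < r -> exists M : R,
      lower_bound_on f1 r M Phi /\
      forall N : nat, lower_bound_on f1 r M (PhiN N))
    (condB : forall r, 0 < r -> exists2 K : R, 0 < K &
      upper_bound_on r K Phi /\
      forall N : nat, upper_bound_on r K (PhiN N))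
    (f3_gt0 : forall s, 0 <= s -> 0 < f3 s)
    (f3_nd : {in Num.nneg &, {homo f3 : s t / s <= t}})
    (Phi_approx : forall (N : nat) (u : X),
      `|Phi u y - PhiN N u y| <= f3 `|u| * rho N)
    (rho_cvg0 : rho @ \oo --> (0 : R)) :
  ((completion mu0).-integrable [set: completed_type mu0]
     (fun u : X => (f3 `|u| * f1 `|u|)%:E) ->
   exists2 D : R, 0 < D &
     forall N : nat,
       (dTV (completion mu0) muy (muyN N) <= (D * rho N)%:E)%E) /\
  ((completion mu0).-integrable [set: completed_type mu0]
     (fun u : X => (f3 `|u| ^+ 2 * f1 `|u|)%:E) ->
   exists2 D' : R, 0 < D' &
     forall N : nat,
       (dH (completion mu0) muy (muyN N) <= (D' * rho N)%:E)%E).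
Proof.
have y_in r : `|y| < r -> ball (0 : Y) r y.
  by rewrite -ball_normE /= sub0r normrN.
have ry0 : 0 < `|y| + 1 by rewrite ltr_wpDl.
have [M [Phi_ge PhiN_ge]] := condA _ ry0.
have {}Phi_ge u : M - ln (f1 `|u|) <= Phi u y.
  by apply: Phi_ge; apply: y_in; rewrite ltrDl.
have {}PhiN_ge N u : M - ln (f1 `|u|) <= PhiN N u y.
  by apply: PhiN_ge; apply: y_in; rewrite ltrDl.
have [r r0 muB] := exists_ball_completion_gt0 mu0.
set B := ball (0 : X) r in muB.
have mB : measurable (B : set (completed_type mu0)).
  exact: completion_measurable_open (ball_open _ _).
(* One radius must serve both balls: it exceeds [r] in [X], so as to contain
   [B], and [`|y|] in [Y]. *)
have [K K0 [Phi_le PhiN_le]] := condB _ (ltr_pwDl r0 (ltW ry0)).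
have sub_ball u : B u -> ball (0 : X) (r + (`|y| + 1)) u.
  by apply: le_ball; rewrite lerDl ltW.
have yK : ball (0 : Y) (r + (`|y| + 1)) y.
  by apply: y_in; rewrite addrC -addrA ltrDl addr_gt0.
have {}Phi_le u : B u -> Phi u y <= K by move=> /sub_ball Bu; exact: Phi_le.
have {}PhiN_le N u : B u -> PhiN N u y <= K.
  by move=> /sub_ball Bu; exact: PhiN_le.
have f1_gt0 (u : X) : 0 < f1 `|u| by rewrite (lt_le_trans ltr01)// f1_ge1.
(* [f3] is positive at [0], so the approximation bound forces the sign of
   [rho]. *)
have rho_ge0 N : 0 <= rho N.
  rewrite -(pmulr_rge0 _ (f3_gt0 _ (normr_ge0 (0 : X)))).
  exact: le_trans (Phi_approx N 0).
set C := expR K / fine (completion mu0 B).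
have C0 : 0 <= C by rewrite divr_ge0 ?expR_ge0// fine_ge0.
have expM (u : X) : expR (- (M - ln (f1 `|u|))) = expR (- M) * f1 `|u|.
  by rewrite opprB addrC expRD lnK ?posrE ?f1_gt0.
have mT : measurable [set: completed_type mu0] by exact: measurableT.
split => [if3f1|if3f1].
- set I := \int[completion mu0]_u (f3 `|u : X| * f1 `|u : X|).
  have I0 : 0 <= I.
    by apply: Rintegral_ge0 => u _; rewrite mulr_ge0// ltW// f3_gt0.
  (* The summand [1] makes positivity immediate; [rho N >= 0] absorbs it. *)
  exists (C * expR (- M) * I + 1).
    by rewrite ltr_wpDl// mulr_ge0// mulr_ge0// expR_ge0.
  move=> N; pose k := expR (- M) * rho N.
  pose F : completed_type mu0 -> R := fun u : X => k * (f3 `|u| * f1 `|u|).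
  have h := dTV_gibbs_le (F := F) muyE (muyNE N) mB muB (PhiN_le N)
    (integrableZl mT k if3f1).
  apply: (le_trans (h _)) => [u|]; rewrite /F.
    apply: le_trans (lipschitz_expRN (Phi_ge u) (PhiN_ge N u)) _.
    rewrite expM.
    have -> : k * (f3 `|u| * f1 `|u|) =
      (expR (- M) * f1 `|u|) * (f3 `|u| * rho N) by rewrite /k; ring.
    by rewrite ler_wpM2l// mulr_ge0 ?expR_ge0// ltW.
  rewrite lee_fin RintegralZl// -/C -/I.
  have -> : C * (k * I) = C * expR (- M) * I * rho N by rewrite /k; ring.
  by rewrite ler_wpM2r// lerDl.
- set I := \int[completion mu0]_u (f3 `|u : X| ^+ 2 * f1 `|u : X|).
  have I0 : 0 <= I.
    by apply: Rintegral_ge0 => u _; rewrite mulr_ge0 ?sqr_ge0// ltW.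
  set D2 := 2^-1 * (C * (expR (- M) / 4 * I)).
  have D20 : 0 <= D2.
    by rewrite mulr_ge0 ?invr_ge0// mulr_ge0// mulr_ge0// divr_ge0 ?expR_ge0.
  exists (Num.sqrt D2 + 1); first by rewrite ltr_wpDl.
  move=> N; pose k := expR (- M) / 4 * rho N ^+ 2.
  pose F : completed_type mu0 -> R :=
    fun u : X => k * (f3 `|u| ^+ 2 * f1 `|u|).
  have h := dH_gibbs_le (F := F) muyE (muyNE N) mB muB Phi_le (PhiN_le N)
    (integrableZl mT k if3f1).
  apply: (le_trans (h _)) => [u|]; rewrite /F.
    set m := M - ln (f1 `|u|).
    (* Halving the potentials halves both the lower bound and the distance;
       squaring turns the halves into the exponent [- m] and the factor
       [1/4] of [k]. *)
    have half a : m <= a -> m / 2 <= a / 2 by move=> ma; rewrite ler_pM2r.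
    have := lipschitz_expRN (half _ (Phi_ge u)) (half _ (PhiN_ge N u)).
    have dist_half : `|Phi u y / 2 - PhiN N u y / 2| <= f3 `|u| * rho N / 2.
      by rewrite -mulrBl normrM (ger0_norm (_ : 0 <= 2^-1)) ?ler_wpM2r ?invr_ge0.
    move=> /le_trans/(_ (ler_wpM2l (expR_ge0 _) dist_half)).
    move=> /(lerXn2r 2); rewrite !nnegrE => /(_ (normr_ge0 _)).
    have b0 : 0 <= expR (- (m / 2)) * (f3 `|u| * rho N / 2).
      by rewrite !mulr_ge0 ?expR_ge0// ltW// f3_gt0.
    move=> /(_ b0); rewrite real_normK ?num_real// => /le_trans; apply.
    rewrite exprMn -expRM_natl.
    have -> : 2%:R * - (m / 2) = - m by field.
    by rewrite expM /k le_eqVlt; apply/orP; left; apply/eqP; field.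
  rewrite lee_fin RintegralZl// -/C -/I.
  have -> : 2^-1 * (C * (k * I)) = D2 * rho N ^+ 2 by rewrite /k /D2; ring.
  rewrite sqrtrM// sqrtr_sqr ger0_norm//.
  by rewrite ler_wpM2r// lerDl.
Qed.
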